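(* Let $\mathcal{H}(X,Y)$ be a solution to the reduced interpolation problem $\mathbf{RIP}_{1,-1}(\mathcal{P}^*,M^* )$ and let $$\mathcal{Q}(X,Y)=\psi(X)\,\mathcal{H}\!\left(X,\frac{Y-e(X)}{g(X)}\right)$$ be the corresponding solution to the original interpolation problem $\mathbf{IP}_{1,k-1}(\mathcal{P},M)$. If $\mathcal{Q}(X,Y)$ has a factor $Y-f(X)$ in $\mathbb{F}_q[X,Y]$, where $f(X)\in\mathbb{F}_q[X]$ and $\deg f(X)<k$, then $\mathcal{H}(X,Y)$ has a factor in $\mathbb{F}_q[X,Y]$ of the form $$Y\sigma(X)-\omega(X)=\sigma(X)\left(Y-\frac{\omega(X)}{\sigma(X)}\right),$$ where $\sigma(X)$ is the error-locator polynomial and $\omega(X)\in\mathbb{F}_q[X]$ is an error-evaluator polynomial for the re-encoding positions with respect to $f(X)$.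
   Context: $\mathbb{F}_q$ is the finite field with $q$ elements, $\mathcal{D}\subseteq\mathbb{F}_q$ is an evaluation set, and $1\le k\le|\mathcal{D}|$ is an integer. For integer weights $w_X,w_Y$ (possibly negative), the $(w_X,w_Y)$-weighted degree $\deg_{w_X,w_Y}\mathcal{A}$ of a nonzero $\mathcal{A}=\sum a_{i,j}X^iY^j\in\mathbb{F}_q[X,Y]$ is $\max\{iw_X+jw_Y : a_{i,j}\ne0\}$. For nonzero $\mathcal{A}$ and $(\alpha,\beta)\in\mathbb{F}_q^2$, writing $\mathcal{A}=\sum a_{i,j}(X-\alpha)^i(Y-\beta)^j$, let $\mu_{\alpha,\beta}(\mathcal{A})=\min\{i+j : a_{i,j}\neq0\}$. For $m\in\mathbb{Z}$, $[m]^+=\max\{m,0\}$. Points and original problem: $\mathcal{P}=\{(x_1,y_1),\dots,(x_s,y_s)\}$ is a set of $s$ distinct points with $x_i\in\mathcal{D}$, $y_i\in\mathbb{F}_q$ (the $x_i$ need not be distinct), with positive integer multiplicities $M=\{m_{x_1,y_1},\dots,m_{x_s,y_s}\}$. A solution to $\mathbf{IP}_{1,k-1}(\mathcal{P},M)$ is a nonzero $\mathcal{Q}\in\mathbb{F}_q[X,Y]$ with $\mu_{x_i,y_i}(\mathcal{Q})\ge m_{x_i,y_i}$ for all $(x_i,y_i)\in\mathcal{P}$ whose $(1,k-1)$-weighted degree is minimal among all nonzero polynomials satisfying these constraints. Re-encoding: it is assumed that $x_1,\dots,x_k$ are pairwise distinct; $\mathcal{R}=\{(x_1,y_1),\dots,(x_k,y_k)\}\subseteq\mathcal{P}$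 is the re-encoding point set, $\nu_i=m_{x_i,y_i}$ for $1\le i\le k$, and $e(X)\in\mathbb{F}_q[X]$ is the unique polynomial of degree $<k$ with $e(x_i)=y_i$ for $1\le i\le k$. Define $g(X)=\prod_{i=1}^k(X-x_i)$, $\psi(X)=\prod_{i=1}^k(X-x_i)^{\nu_i}$, and $t_j(X)=\prod_{i=1}^k(X-x_i)^{[j-\nu_i]^+}$ for $j\ge0$. Let $g'$ be the derivative of $g$. Reduced problem: let $\mathcal{S}$ (resp. $\mathcal{T}$) be the set of points of $\mathcal{P}\setminus\mathcal{R}$ whose $X$-coordinate is not (resp. is) among $x_1,\dots,x_k$. For $(x,y)\in\mathcal{P}\setminus\mathcal{R}$ put $z=(y-e(x))/g(x)$ if $(x,y)\in\mathcal{S}$ and $z=(y-e(x))/g'(x)$ if $(x,y)\in\mathcal{T}$. Let $\mathcal{S}^*,\mathcal{T}^*$ be the sets of resulting points $(x,z)$ coming from $\mathcal{S}$ and $\mathcal{T}$ respectively, $\mathcal{P}^*=\mathcal{S}^*\cup\mathcal{T}^*$, and assign to each $(x,z)\in\mathcal{P}^*$ the multiplicity $m_{x,z}$ equal to the multiplicity $m_{x,y}$ of the point $(x,y)$ it comes from; $M^*$ is the collection of these multiplicities. A solution to $\mathbf{RIP}_{1,-1}(\mathcal{P}^*,M^* )$ is a nonzero $\mathcal{H}\in\mathbb{F}_q[X,Y]$ such that: (1) $\mathcal{H}(X,Y)=\sum_{j\ge0}q_j(X)t_j(X)Y^j$ for some $q_j(X)\in\mathbb{F}_q[X]$; (2)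 $\mu_{x,z}(\mathcal{H})\ge m_{x,z}$ for all $(x,z)\in\mathcal{S}^*$; (3) for all $(x,z)\in\mathcal{T}^*$, with $i\in\{1,\dots,k\}$ the index such that $x=x_i$, $\mu_{x,z}\big((X-x)^{\nu_i}\mathcal{H}(X,\tfrac{Y}{X-x})\big)\ge m_{x,z}$ (the argument is a polynomial by (1)); and $\deg_{1,-1}\mathcal{H}$ is minimal among all nonzero polynomials satisfying (1)–(3). Error polynomials: given $f$, let $\mathcal{E}=\{i\in\{1,\dots,k\} : y_i\ne f(x_i)\}$ and $\mathcal{E}^c=\{1,\dots,k\}\setminus\mathcal{E}$. The error-locator polynomial for the re-encoding positions with respect to $f$ is $\sigma(X)=\prod_{i\in\mathcal{E}}(X-x_i)$. Put $\lambda(X)=\prod_{i\in\mathcal{E}^c}(X-x_i)$. An error-evaluator polynomial for the re-encoding positions with respect to $f$ is a polynomial $\omega(X)\in\mathbb{F}_q[X]$ such that $f(x_i)-y_i=\omega(x_i)\lambda(x_i)=\omega(x_i)\,g'(x_i)/\sigma'(x_i)$ for every $i\in\mathcal{E}$. *)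

(* Defs.v *)
From HB Require Import structures.
From mathcomp Require Import all_boot all_order all_algebra.
Set Implicit Arguments.
Unset Strict Implicit.
Unset Printing Implicit Defensive.
Import Order.TTheory GRing.Theory Num.Theory.
Local Open Scope ring_scope.

Notation "x %:F" := (@FracField.tofrac _ x) : ring_scope.

(** A bivariate polynomial of F[X,Y] is an element of {poly {poly F}}: the
    outer indeterminate is Y and the inner one is X, so that the coefficient
    of X^i Y^j in A is A`_j`_i.  Since {poly F} is not a field, the relation
    %| of polydiv (a pseudo-division) is not divisibility in F[X,Y]; hence the
    explicit [bi_dvd]. *)

Definition bi_dvd (F : fieldType) (A B : {poly {poly F}}) : Prop :=
  exists C : {poly {poly F}}, B = C * A.

(** The pairs (i, j) such that X^i Y^j has a nonzero coefficient in A. *)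
Definition bi_supp (F : fieldType) (A : {poly {poly F}}) : seq (nat * nat) :=
  [seq ij <- [seq (i, j) | j <- iota 0 (size A), i <- iota 0 (size A`_j)]
     | A`_(ij.2)`_(ij.1) != 0].

(** For A != 0 the support is not empty, and starting the maximum (and, in
    [bi_mult], the minimum) from one of its values is harmless; the value 0
    taken at A = 0 is junk. *)
Definition wdeg (F : fieldType) (wX wY : int) (A : {poly {poly F}}) : int :=
  let ws := [seq (ij.1)%:Z * wX + (ij.2)%:Z * wY | ij <- bi_supp A] in
  \big[Num.max/head 0 ws]_(w <- ws) w.

(** A(X + a, Y + b): its coefficients are those of A expanded in powers of
    X - a and Y - b. *)
Definition bi_shift (F : fieldType) (a b : F) (A : {poly {poly F}})
    : {poly {poly F}} :=
  map_poly (fun p : {poly F} => p \Po ('X + a%:P)) A \Po ('X + b%:P%:P).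

Definition bi_mult (F : fieldType) (a b : F) (A : {poly {poly F}}) : nat :=
  let ds := [seq (ij.1 + ij.2)%N | ij <- bi_supp (bi_shift a b A)] in
  \big[minn/head 0%N ds]_(d <- ds) d.

(** The image of A in F(X)[Y]. *)
Definition bi_frac (F : fieldType) (A : {poly {poly F}})
    : {poly {fraction {poly F}}} :=
  map_poly (@FracField.tofrac {poly F}) A.

(** c(X) A(X, u(X, Y)), where u may have denominators in X. *)
Definition frac_subst (F : fieldType) (c : {poly F}) (A : {poly {poly F}})
    (u : {poly {fraction {poly F}}}) : {poly {fraction {poly F}}} :=
  c%:F *: (bi_frac A \Po u).

(** Interpolation problem with weights (1, k - 1), for the points (x i, y i)
    with multiplicities m i. *)
Definition IP_admissible (F : fieldType) (s : nat) (x y : 'I_s -> F)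
    (m : 'I_s -> nat) (Q : {poly {poly F}}) : Prop :=
  Q != 0 /\ forall i : 'I_s, (m i <= bi_mult (x i) (y i) Q)%N.

Definition IP_solution (F : fieldType) (k s : nat) (x y : 'I_s -> F)
    (m : 'I_s -> nat) (Q : {poly {poly F}}) : Prop :=
  IP_admissible x y m Q /\
  forall Q', IP_admissible x y m Q' ->
    wdeg 1 (k%:Z - 1) Q <= wdeg 1 (k%:Z - 1) Q'.

(** Re-encoding data.  The s points are indexed by 'I_s, and the re-encoding
    points are the first k of them. *)
Definition reenc (T : Type) (k s : nat) (hks : (k <= s)%N) (a : 'I_s -> T)
    : 'I_k -> T := fun i => a (widen_ord hks i).

Definition re_g (F : fieldType) (k : nat) (xr : 'I_k -> F) : {poly F} :=
  \prod_(i < k) ('X - (xr i)%:P).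

Definition re_psi (F : fieldType) (k : nat) (xr : 'I_k -> F) (nu : 'I_k -> nat)
    : {poly F} := \prod_(i < k) ('X - (xr i)%:P) ^+ nu i.

(** The truncated subtraction of nat is [j - nu i]^+. *)
Definition re_t (F : fieldType) (k : nat) (xr : 'I_k -> F) (nu : 'I_k -> nat)
    (j : nat) : {poly F} := \prod_(i < k) ('X - (xr i)%:P) ^+ (j - nu i).

(** Indices of the points outside the re-encoding set whose X-coordinate is
    not (S), resp. is (T), a re-encoding coordinate. *)
Definition re_S (F : fieldType) (k s : nat) (hks : (k <= s)%N) (x : 'I_s -> F)
    : {set 'I_s} :=
  [set i : 'I_s | (k <= i)%N && (x i \notin codom (reenc hks x))].

Definition re_T (F : fieldType) (k s : nat) (hks : (k <= s)%N) (x : 'I_s -> F)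
    : {set 'I_s} :=
  [set i : 'I_s | (k <= i)%N && (x i \in codom (reenc hks x))].

(** The second coordinate of the point (x i, z i) of the reduced problem; only
    used for i in [re_S] or [re_T]. *)
Definition re_z (F : fieldType) (k s : nat) (hks : (k <= s)%N)
    (x y : 'I_s -> F) (e : {poly F}) (i : 'I_s) : F :=
  let g := re_g (reenc hks x) in
  if i \in re_S hks x then (y i - e.[x i]) / g.[x i]
  else (y i - e.[x i]) / (g^`()).[x i].

(** Reduced interpolation problem with weights (1, -1), for the points
    (x l, z l) with l in S or in T; the multiplicity of (x l, z l) is m l.  In
    the third condition K is the polynomial (X - x)^nu H(X, Y / (X - x)). *)
Definition RIP_admissible (F : fieldType) (k s : nat) (xr : 'I_k -> F)
    (nu : 'I_k -> nat) (S T : {set 'I_s}) (x z : 'I_s -> F) (m : 'I_s -> nat)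
    (H : {poly {poly F}}) : Prop :=
  [/\ H != 0,
      exists q : {poly {poly F}},
        H = \sum_(j < size q) (q`_j * re_t xr nu j) *: 'X^j,
      forall l, l \in S -> (m l <= bi_mult (x l) (z l) H)%N
    & forall l, l \in T -> forall i : 'I_k, x l = xr i ->
        exists2 K : {poly {poly F}},
          bi_frac K = frac_subst (('X - (x l)%:P) ^+ nu i) H
                        ((('X - (x l)%:P)%:F)^-1 *: 'X)
        & (m l <= bi_mult (x l) (z l) K)%N].

Definition RIP_solution (F : fieldType) (k s : nat) (xr : 'I_k -> F)
    (nu : 'I_k -> nat) (S T : {set 'I_s}) (x z : 'I_s -> F) (m : 'I_s -> nat)
    (H : {poly {poly F}}) : Prop :=
  RIP_admissible xr nu S T x z m H /\
  forall H', RIP_admissible xr nu S T x z m H' ->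
    wdeg 1 (-1) H <= wdeg 1 (-1) H'.

Definition err_set (F : fieldType) (k : nat) (xr yr : 'I_k -> F) (f : {poly F})
    : {set 'I_k} := [set i | yr i != f.[xr i]].

Definition err_locator (F : fieldType) (k : nat) (xr yr : 'I_k -> F)
    (f : {poly F}) : {poly F} :=
  \prod_(i in err_set xr yr f) ('X - (xr i)%:P).

Definition err_colocator (F : fieldType) (k : nat) (xr yr : 'I_k -> F)
    (f : {poly F}) : {poly F} :=
  \prod_(i in ~: err_set xr yr f) ('X - (xr i)%:P).

Definition err_evaluator (F : fieldType) (k : nat) (xr yr : 'I_k -> F)
    (f omega : {poly F}) : Prop :=
  let sigma := err_locator xr yr f in
  let lambda := err_colocator xr yr f in
  forall i, i \in err_set xr yr f ->
    f.[xr i] - yr i = omega.[xr i] * lambda.[xr i] /\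
    f.[xr i] - yr i
      = omega.[xr i] * ((re_g xr)^`()).[xr i] / (sigma^`()).[xr i].

(* Main.v *)
Require Import Defs.
From HB Require Import structures.
From mathcomp Require Import all_boot all_order all_algebra.
Set Implicit Arguments.
Unset Strict Implicit.
Unset Printing Implicit Defensive.
Import Order.TTheory GRing.Theory Num.Theory.
Local Open Scope ring_scope.

(** Put omega = (f - e) / lambda, a polynomial because f - e vanishes at the
    re-encoding points where f agrees with y.  Since g = sigma * lambda, the root
    f of Q becomes the root (f - e) / g = omega / sigma of H.  As omega does not
    vanish at the error positions, sigma and omega are coprime, so by Gauss's
    lemma sigma Y - omega divides H over F[X]. *)

Lemma bi_frac_linear (F : fieldType) (a b : {poly F}) :
  bi_frac (a%:P * 'X - b%:P) = a%:F%:P * 'X - b%:F%:P.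
Proof.
rewrite /bi_frac rmorphB rmorphM /= map_polyX.
by rewrite !(map_polyC (@FracField.tofrac _)).
Qed.

Lemma linear_polyE (K : fieldType) (a b : K) :
  a != 0 -> a%:P * 'X - b%:P = a *: ('X - (b / a)%:P).
Proof.
by move=> a0; rewrite scalerBr -!mul_polyC -polyCM [a * _]mulrC divfK.
Qed.

(** Clearing denominators shows that sigma divides the leading coefficient of H,
    so the long division of H by sigma Y - omega needs no denominators. *)
Lemma bi_dvd_root_frac (F : fieldType) (sigma omega : {poly F})
    (H : {poly {poly F}}) :
  sigma != 0 -> coprimep sigma omega ->
  root (bi_frac H) (omega%:F / sigma%:F) -> bi_dvd (sigma%:P * 'X - omega%:P) H.
Proof.
move=> sigma0 cop; have sF0 : sigma%:F != 0 by rewrite tofrac_eq0.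
have [n] := ubnP (size H); elim: n H => // n IHn H; rewrite ltnS => szH rootH.
case: n => [|n] in IHn szH *.
  by exists 0; rewrite mul0r; apply/eqP; rewrite -size_poly_eq0 -leqn0.
have szHF : (size (bi_frac H) <= n.+1)%N by rewrite (leq_trans (size_poly _ _)).
have swap (K : fieldType) (h w u v : K) :
    v != 0 -> h * w * u = u * v * (h * (w / v)).
  by move=> v0; rewrite [RHS]mulrACA [v * _]mulrC divfK // [LHS]mulrC mulrA.
(* [H] has degree at most [n] in Y, so this sum is [sigma ^+ n] times [H] evaluated at
   [omega / sigma]; it vanishes already in F[X] because F[X] embeds in F(X). *)
have sum0 : \sum_(j < n.+1) H`_j * omega ^+ j * sigma ^+ (n - j) = 0.
  apply/eqP; rewrite -tofrac_eq0 rmorph_sum /=; apply/eqP.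
  transitivity (sigma%:F ^+ n * (bi_frac H).[omega%:F / sigma%:F]); last first.
    by rewrite (rootP rootH) mulr0.
  rewrite (horner_coef_wide _ szHF) mulr_sumr; apply: eq_bigr => j _.
  rewrite coef_map /= !rmorphM !rmorphXn /= exprMn exprVn.
  have jn : (j <= n)%N by rewrite -ltnS.
  have -> : sigma%:F ^+ n = sigma%:F ^+ (n - j) * sigma%:F ^+ j.
    by rewrite -exprD subnK.
  by apply: swap; rewrite expf_neq0.
(* Every term of [sum0] with [j < n] carries a factor [sigma], hence [sigma] divides the remaining
   term, the leading coefficient times [omega ^+ n]; coprimality removes the power of [omega]. *)
have /dvdpP[c Hn] : sigma %| H`_n.
  have copn : coprimep sigma (omega ^+ n) by apply: coprimep_expr.
  rewrite -(Gauss_dvdpl _ copn); move/eqP: sum0.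
  rewrite big_ord_recr /= subnn mulr1 addrC addr_eq0 => /eqP->.
  rewrite dvdpNr; apply: (big_ind (fun p => sigma %| p)) => [|p q|j _].
  - exact: dvdp0.
  - exact: dvdp_add.
  - by rewrite dvdp_mull // -subnSK // exprS dvdp_mulr.
(* With no Y to cancel, [sum0] itself reads [H = 0]. *)
case: n => [|n] in IHn szH szHF sum0 Hn *.
  exists 0; rewrite mul0r (size1_polyC szH).
  by move: sum0; rewrite big_ord1 !mulr1 => ->.
(* One step of long division: [c * sigma] is the coefficient of Y^(n+1) in [H], so the subtraction
   lowers the degree bound, and it keeps the root because [sigma Y - omega] vanishes at
   [omega / sigma]. *)
have [||C HC] := IHn (H - c%:P * 'X^n * (sigma%:P * 'X - omega%:P)).
- rewrite ltnS; apply/leq_sizeP => j; rewrite leq_eqVlt => /predU1P[<-|nj].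
    rewrite coefB -mulrA coefCM coefXnM ltnNge leqnSn /= subSnn.
    by rewrite coefB coefMX coefC coefC /= subr0 Hn subrr.
  rewrite coefB -mulrA coefCM coefXnM ltnNge (ltnW (ltnW nj)) /=.
  rewrite coefB coefMX !coefC (leq_sizeP _ _ szH) //.
  have /subnSK <- : (n < j)%N by exact: ltnW.
  by rewrite subn_eq0 leqNgt nj /= subr0 mulr0 subrr.
- apply/rootP; rewrite /bi_frac rmorphB rmorphM /= -/(bi_frac H).
  rewrite -/(bi_frac (_ - _)) bi_frac_linear linear_polyE // hornerD hornerN (rootP rootH).
  by rewrite hornerM hornerZ hornerXsubC subrr !mulr0 subr0.
by exists (C + c%:P * 'X^n); rewrite mulrDl -HC subrK.
Qed.

Section LinearProducts.

Variables (F : fieldType) (I : finType) (a : I -> F).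
Implicit Types (A : {set I}) (p : {poly F}).

Lemma prod_XsubC_monic A : \prod_(i in A) ('X - (a i)%:P) \is monic.
Proof. by apply: monic_prod => i _; apply: monicXsubC. Qed.

Lemma root_prod_XsubC_in A i :
  i \in A -> (\prod_(j in A) ('X - (a j)%:P)).[a i] = 0.
Proof. by move=> iA; rewrite (bigD1 i) //= hornerM hornerXsubC subrr mul0r. Qed.

Lemma coprimep_prod_XsubC A p :
  (forall i, i \in A -> p.[a i] != 0) ->
  coprimep (\prod_(i in A) ('X - (a i)%:P)) p.
Proof.
move=> pA; apply: (big_ind (fun q => coprimep q p)) => [|q r|i iA].
- exact: coprime1p.
- by rewrite coprimepMl => -> ->.
- by rewrite coprimep_sym coprimep_XsubC; apply: pA.
Qed.

Hypothesis a_inj : injective a.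

Lemma dvdp_prod_XsubC A p :
  (forall i, i \in A -> p.[a i] = 0) -> \prod_(i in A) ('X - (a i)%:P) %| p.
Proof.
move=> pA; rewrite -big_enum -(big_map a xpredT (fun c => 'X - c%:P)).
apply: uniq_roots_dvdp.
  by apply/allP => _ /mapP[i iA ->]; apply/rootP/pA; rewrite -mem_enum.
by rewrite uniq_rootsE map_inj_uniq ?enum_uniq.
Qed.

(** At [a i] the product rule leaves only the product of the differences [a i - a j] over the other
    indices, nonzero by injectivity. *)
Lemma deriv_prod_XsubC_neq0 A i :
  i \in A -> ((\prod_(j in A) ('X - (a j)%:P))^`()).[a i] != 0.
Proof.
move=> iA; rewrite (bigD1 i) //= derivM derivXsubC mul1r hornerD hornerM.
rewrite hornerXsubC subrr mul0r addr0 horner_prod; apply/prodf_neq0 => j.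
by case/andP=> _ ji; rewrite hornerXsubC subr_eq0 (inj_eq a_inj) eq_sym.
Qed.

End LinearProducts.

Lemma re_g_split (F : fieldType) (k : nat) (xr yr : 'I_k -> F) (f : {poly F}) :
  re_g xr = err_locator xr yr f * err_colocator xr yr f.
Proof.
rewrite /re_g (bigID (mem (err_set xr yr f))) /=; congr (_ * _).
by apply: eq_bigl => i; rewrite [RHS]in_setC.
Qed.

(** Setting Y = f in the identity for [Q] gives [0 = psi * H((f - e) / g)] in the field F(X), where
    [psi] can be cancelled. *)
Lemma frac_subst_root (F : fieldType) (psi g e f : {poly F})
    (H Q : {poly {poly F}}) :
  psi != 0 ->
  bi_frac Q = frac_subst psi H ((g%:F)^-1 *: ('X - (e%:F)%:P)) ->
  bi_dvd ('X - f%:P) Q -> root (bi_frac H) ((f - e)%:F / g%:F).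
Proof.
move=> psi0 QH [C QC]; apply/eqP.
have : (bi_frac Q).[f%:F] = 0.
  by rewrite QC /bi_frac horner_map /= hornerM hornerXsubC subrr mulr0 rmorph0.
rewrite QH /frac_subst hornerZ horner_comp hornerZ hornerXsubC => /eqP.
by rewrite mulf_eq0 tofrac_eq0 (negPf psi0) /= rmorphB mulrC => /eqP.
Qed.

Theorem theorem10 (F : finFieldType) (D : {set F}) (k s : nat)
    (hk1 : (1 <= k)%N) (hkD : (k <= #|D|)%N) (hks : (k <= s)%N)
    (x y : 'I_s -> F) (m : 'I_s -> nat)
    (hxD : forall i, x i \in D)
    (hP : injective (fun i => (x i, y i)))
    (hm : forall i, (0 < m i)%N)
    (hR : injective (reenc hks x))
    (e : {poly F}) (he_size : (size e <= k)%N)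
    (he : forall i : 'I_k, e.[reenc hks x i] = reenc hks y i)
    (H Q : {poly {poly F}})
    (hH : RIP_solution (reenc hks x) (reenc hks m) (re_S hks x) (re_T hks x)
            x (re_z hks x y e) m H)
    (hQH : bi_frac Q
           = frac_subst (re_psi (reenc hks x) (reenc hks m)) H
               (((re_g (reenc hks x))%:F)^-1 *: ('X - (e%:F)%:P)))
    (hQ : IP_solution k x y m Q)
    (f : {poly F}) (hf : (size f <= k)%N)
    (hQf : bi_dvd ('X - f%:P) Q) :
  exists omega : {poly F},
    let sigma := err_locator (reenc hks x) (reenc hks y) f in
    [/\ err_evaluator (reenc hks x) (reenc hks y) f omega,
        bi_dvd (sigma%:P * 'X - omega%:P) H
      & bi_frac (sigma%:P * 'X - omega%:P)
        = sigma%:F *: ('X - (omega%:F / sigma%:F)%:P)].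
Proof.
set xr := reenc hks x; set yr := reenc hks y.
pose sigma := err_locator xr yr f; pose lambda := err_colocator xr yr f.
have gE : re_g xr = sigma * lambda := re_g_split xr yr f.
have sigma0 : sigma != 0 by apply/monic_neq0/prod_XsubC_monic.
have lambda0 : lambda != 0 by apply/monic_neq0/prod_XsubC_monic.
have psi0 : re_psi xr (reenc hks m) != 0.
  by apply/prodf_neq0 => i _; rewrite expf_neq0 // polyXsubC_eq0.
have /dvdpP[omega feE] : lambda %| f - e.
  apply: dvdp_prod_XsubC => // i; rewrite !inE negbK => /eqP yf.
  by rewrite hornerD hornerN he -/yr yf subrr.
(* Since [e] interpolates [yr], this is [f - e = omega * lambda] evaluated at [xr i]; it holds at
   every re-encoding position. *)
have valE (i : 'I_k) : f.[xr i] - yr i = omega.[xr i] * lambda.[xr i].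
  by rewrite -hornerM -feE hornerD hornerN he.
(* By [valE], a zero of [omega] at [xr i] would make [f] agree with [yr i], so [i] would not be an
   error position. *)
have cop : coprimep sigma omega.
  apply: coprimep_prod_XsubC => i; rewrite inE; apply: contraNneq => w0.
  by rewrite eq_sym -subr_eq0 valE w0 mul0r.
exists omega => /=; split.
- move=> i iE; split; first exact: valE.
  (* In [g' = sigma' * lambda + sigma * lambda'] the second term vanishes at an error position, so
     [g' / sigma'] takes the value of [lambda] there. *)
  rewrite -/sigma gE derivM hornerD !hornerM (root_prod_XsubC_in _ iE) mul0r.
  rewrite addr0 valE -mulrA; congr (_ * _).
  by rewrite mulrAC mulfV ?mul1r ?deriv_prod_XsubC_neq0.
- apply: bi_dvd_root_frac => //; rewrite -/sigma.
  have := frac_subst_root psi0 hQH hQf.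
  (* The factor [lambda] cancels between [f - e = omega * lambda] and [g = sigma * lambda]. *)
  by rewrite -/xr gE feE !rmorphM /= -mulf_div divff ?mulr1 ?tofrac_eq0.
- by rewrite bi_frac_linear linear_polyE // tofrac_eq0.
Qed.
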